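(* For every $\delta>0$ there exists $n_\delta\in\mathbb{N}$ such that for every $n\ge n_\delta$ we have $$\mathrm{ex}_{C_5}(C_3,n)\le \frac{n^2}{25}+\frac{3n}{25}+\delta n.$$
   Context: All graphs are finite and simple. $C_\ell$ denotes the cycle of length $\ell$. Let $F$ and $H$ be fixed graphs. Let $G=\bigcup_{i=1}^k F_i$ be a graph whose edge set is the union of $k$ pairwise edge-disjoint subgraphs $F_1,\dots,F_k$, each isomorphic to $F$. A subgraph of $G$ is called multicolored (with respect to this decomposition) if it shares at most one edge with $F_i$ for every $i$. Then $\mathrm{ex}_F(H,n)$ is the maximum $k$ such that there exists a graph $G=\bigcup_{i=1}^k F_i$ on $n$ vertices, decomposed in this way, with no multicolored copy of $H$. *)

(* Defs.v *)
From HB Require Import structures.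
From mathcomp Require Import all_boot all_order all_algebra.
From mathcomp Require Import reals boolp.
From mathcomp Require classical_sets.

Set Implicit Arguments.
Unset Strict Implicit.
Unset Printing Implicit Defensive.

Record sgraph := SGraph {
  svertex :> finType;
  adj : rel svertex;
  adj_sym : symmetric adj;
  adj_irrefl : irreflexive adj }.

Definition isomorphic (F H : sgraph) : Prop :=
  exists2 f : F -> H, bijective f & forall x y, adj (f x) (f y) = adj x y.

Definition edge_set (V : finType) (e : rel V) : {set {set V}} :=
  [set [set p.1; p.2] | p : V * V & e p.1 p.2].

Definition edges (G : sgraph) : {set {set G}} := edge_set (@adj G).

Record subgraph (G : sgraph) := Subgraph {
  sub_verts : {set G};
  sub_adj : rel G;
  sub_adj_sym : symmetric sub_adj;
  sub_adjP : forall x y, sub_adj x y ->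
    [&& x \in sub_verts, y \in sub_verts & adj x y] }.

Definition sub_edges (G : sgraph) (S : subgraph G) : {set {set G}} :=
  edge_set (sub_adj S).

Section SubgraphAsGraph.
Variables (G : sgraph) (S : subgraph G).

Definition sgraph_of_adj : rel {x : G | x \in sub_verts S} :=
  [rel x y | sub_adj S (val x) (val y)].

Lemma sgraph_of_sym : symmetric sgraph_of_adj.
Proof. by move=> x y; rewrite /sgraph_of_adj /= sub_adj_sym. Qed.

Lemma sgraph_of_irrefl : irreflexive sgraph_of_adj.
Proof.
by move=> x; apply/negP => /= /sub_adjP /and3P[_ _]; rewrite adj_irrefl.
Qed.

Definition sgraph_of : sgraph := SGraph sgraph_of_sym sgraph_of_irrefl.

End SubgraphAsGraph.

Section Cycle.
Variable l : nat.

(* This is the cycle C_l only for 3 <= l. *)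
Definition cycle_adj : rel 'I_l :=
  [rel i j | (i != j) && ((j == ordS i) || (i == ordS j))].

Lemma cycle_adj_sym : symmetric cycle_adj.
Proof. by move=> i j; rewrite /cycle_adj /= eq_sym orbC. Qed.

Lemma cycle_adj_irrefl : irreflexive cycle_adj.
Proof. by move=> i; rewrite /cycle_adj /= eqxx. Qed.

Definition cycle_graph : sgraph := SGraph cycle_adj_sym cycle_adj_irrefl.

End Cycle.

Definition decomposition (F G : sgraph) (k : nat) (D : 'I_k -> subgraph G) :
    Prop :=
  [/\ forall i, isomorphic (sgraph_of (D i)) F,
      forall i j, i != j -> [disjoint sub_edges (D i) & sub_edges (D j)]
    & edges G = \bigcup_(i < k) sub_edges (D i)].

Definition multicolored (G : sgraph) (k : nat) (D : 'I_k -> subgraph G)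
    (S : subgraph G) : Prop :=
  forall i, #|sub_edges S :&: sub_edges (D i)| <= 1.

Definition ex_admissible (F H : sgraph) (n k : nat) : Prop :=
  exists (G : sgraph) (D : 'I_k -> subgraph G),
    [/\ #|G| = n, decomposition F D
      & forall S : subgraph G,
          isomorphic (sgraph_of S) H -> ~ multicolored D S].

Definition is_maximum (P : nat -> Prop) (k : nat) : Prop :=
  P k /\ forall m, P m -> m <= k.

(* The default value 0 is taken only when there is no maximum; see ex_numP. *)
Definition ex_num (F H : sgraph) (n : nat) : nat :=
  classical_sets.xget 0 (is_maximum (ex_admissible F H n)).

Lemma edge_setP (V : finType) (e : rel V) (A : {set V}) :
  reflect (exists x y, e x y /\ A = [set x; y]) (A \in edge_set e).
Proof.
apply: (iffP imsetP) => [[[x y] /=]|[x [y [exy ->]]]].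
  by rewrite inE /= => exy ->; exists x, y.
by exists (x, y); rewrite // inE.
Qed.

Lemma isomorphic_sub_edges (F G : sgraph) (S : subgraph G) :
  isomorphic (sgraph_of S) F -> (exists x y : F, adj x y) ->
  exists A, A \in sub_edges S.
Proof.
move=> [f [g fK gK] fE] [x [y]]; rewrite -[x]gK -[y]gK fE /= => gxy.
by exists [set val (g x); val (g y)]; apply/edge_setP;
  exists (val (g x)), (val (g y)).
Qed.

Lemma ex_admissible_le (F H : sgraph) (n k : nat) :
  (exists x y : F, adj x y) -> ex_admissible F H n k -> k <= 2 ^ n.
Proof.
move=> Fe [G [D [Gn [DF Ddis _] _]]].
have [h hP] : {h : 'I_k -> {set G} | forall i, h i \in sub_edges (D i)}.
  have H0 i : {A | A \in sub_edges (D i)}.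
    by apply/cid; apply: isomorphic_sub_edges (DF i) Fe.
  by exists (fun i => projT1 (H0 i)) => i; case: (H0 i).
have hI : injective h.
  move=> i j hij; apply/eqP/negPn/negP => /Ddis /pred0P /(_ (h i)) /=.
  by rewrite hP hij hP.
rewrite -Gn -[k]card_ord -cardsT -card_powerset powersetT cardsT.
exact: leq_card hI.
Qed.

Lemma ex_admissible0 (F H : sgraph) (n : nat) :
  (exists x y : H, adj x y) -> ex_admissible F H n 0.
Proof.
move=> He.
pose G := @SGraph 'I_n [rel _ _ | false] (fun _ _ => erefl) (fun _ => erefl).
have D : 'I_0 -> subgraph G by case.
exists G, D; split; first by rewrite card_ord.
  split; try by case.
  rewrite big_ord0; apply/setP => A; rewrite inE.
  by apply/edge_setP => -[x [y []]].
move=> S /isomorphic_sub_edges /(_ He) [A /edge_setP [x [y [/sub_adjP]]]].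
by rewrite !andbF.
Qed.

Lemma ex_numP (F H : sgraph) (n : nat) :
  (exists x y : F, adj x y) -> (exists x y : H, adj x y) ->
  is_maximum (ex_admissible F H n) (ex_num F H n).
Proof.
move=> Fe He; pose p k := `[< ex_admissible F H n k >].
have p0 : exists k, p k by exists 0; apply/asboolP/ex_admissible0.
have ple k : p k -> k <= 2 ^ n by move=> /asboolP; apply: ex_admissible_le.
case: (ex_maxnP p0 ple) => m /asboolP pm mP.
apply: (@classical_sets.xgetPex _ 0); exists m; split=> // k /asboolP.
exact: mP.
Qed.

(* Main.v *)
Require Import Defs.
From mathcomp Require Import all_boot all_order all_algebra.
From mathcomp Require Import reals boolp.
From mathcomp Require Import zify ring lra.

Set Implicit Arguments.
Unset Strict Implicit.
Unset Printing Implicit Defensive.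

Import GRing.Theory Num.Theory Order.TTheory.

Local Open Scope nat_scope.

(** Let d be the degree in the union G of k edge-disjoint pentagons on n
    vertices, without rainbow triangle.  Summing d along a pentagon C amounts
    to counting, for each vertex u, the neighbours of u on C.  Read around C,
    they form at most two runs, so their number is at most 2 plus the number of
    edges of C that make a triangle with u ([runs_at_most_two]).  Were there no
    triangles, d would sum to at most 2n on each C; since the sum of d ^ 2 is
    twice the total over all pentagons and the sum of d is 10k, convexity would
    give k <= n^2 / 25.

    Triangles cost a term linear in n.  No triangle is rainbow, so a triangle on
    an edge of C with apex off C consists of two consecutive edges of another
    pentagon and of the chord of that pentagon that closes them.  Hence there
    are at most as many such triangles as there are chords, all pentagons taken
    together ([sum_outer_triangles]).  A chord also adds 2 to the degree sum of
    its own pentagon, so the error is at most three times the number of chords.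
    Two chords for each pentagon would give an error of 6k, which is the term
    3n / 25.

    More than two chords on a pentagon force a double chord, that is, two chords
    that share a vertex y ([chords_le]), and double chords are rare.  The two
    chords at y close with an edge of C, so they belong to a single pentagon C'.
    A vertex u adjacent to y and off C and C' then either has no other neighbour
    on C, or makes a triangle with an edge of C or of C'
    ([deg_double_chord]).  When k >= n^2 / 25, the defects of the inequality
    above and the triangles both number O(k) in total, so the degrees of these
    vertices y sum to O(k).  The same inequality keeps the sum of
    (d - 2n/5) ^ 2 at O(k), so vertices of degree below n/5 carry few double
    chords and the others, having degree at least n/5, carry O(k / n) in total
    ([num_double_chords_sparse]).  So there are O(n) double chords, and their
    contribution to the bound on k is O(1) ([pentagons_bound]). *)

(** * Positions on a pentagon *)

Local Notation nxt j := (j + 1)%R.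
Local Notation prv j := (j - 1)%R.

Lemma big_positions (F : 'I_5 -> nat) :
  \sum_j F j = F 0%R + F 1%R + F (nxt 1)%R + F (prv (- 1))%R + F (-1)%R.
Proof.
rewrite !big_ord_recl big_ord0 addn0 !addnA.
by congr (_ + _ + _ + _ + _); congr F; apply: val_inj.
Qed.

(** The positions j with a j but not a (j + t) are the ends of the runs of a
    along the cyclic order of step t; five positions hold at most two runs. *)
Lemma runs_at_most_two (a : 'I_5 -> bool) (t : 'I_5) : t != 0%R ->
  \sum_j a j <= 2 + \sum_j (a j && a (j + t)%R).
Proof.
(* Naming the five values makes every sum over positions computable. *)
move=> t0; have [b0 [b1 [b2 [b3 [b4 bE]]]]] : exists b0 b1 b2 b3 b4,
    forall j, a j = nth false [:: b0; b1; b2; b3; b4] j.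
  exists (a (inord 0)), (a (inord 1)), (a (inord 2)), (a (inord 3)),
    (a (inord 4)) => j.
  by case: j => [[|[|[|[|[|//]]]]] ?]; congr a; apply: val_inj;
     rewrite /= inordK.
under eq_bigr do rewrite bE.
under [in X in _ <= X]eq_bigr do rewrite !bE.
rewrite !big_ord_recl !big_ord0.
by case: t t0 => [[|[|[|[|[|//]]]]] ?] // _;
   case: b0 {bE}; case: b1; case: b2; case: b3; case: b4.
Qed.

Lemma other_positions (j j' : 'I_5) : j' != j ->
  [|| j' == nxt j, j' == prv j, j' == nxt (nxt j) | j' == nxt (nxt (nxt j))].
Proof.
by case: j => [[|[|[|[|[|//]]]]] ?]; case: j' => [[|[|[|[|[|//]]]]] ?].
Qed.

(** Double counting along a relation that only needs to be injective on its
    domain, so that no choice of an image is required. *)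
Lemma leq_sum_rel (S T : finType) (A : pred S) (B : pred T)
    (r : S -> T -> bool) (F : S -> nat) (G : T -> nat) :
  (forall s, A s -> exists t, [/\ B t, r s t & (F s <= G t)]) ->
  (forall s s' t, A s -> A s' -> r s t -> r s' t -> s = s') ->
  (\sum_(s | A s) F s <= \sum_(t | B t) G t).
Proof.
move=> ex inj; pose q s t := [&& B t, r s t & (F s <= G t)].
apply: (@leq_trans (\sum_(s | A s) \sum_(t | q s t) G t)).
  apply: leq_sum => s /ex[t [Bt rst FG]].
  by rewrite (bigD1 t) ?/q ?Bt ?rst //=; apply: leq_trans FG (leq_addr _ _).
rewrite (exchange_big_dep B) /=; last by move=> s t _ /and3P[].
apply: leq_sum => t Bt.
have [s /andP[As qst]|no] := pickP [pred s | A s && q s t]; last first.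
  by rewrite big_pred0.
rewrite (big_pred1 s) // => s' /=.
apply/idP/eqP => [/andP[As' /and3P[_ rs' _]]|->].
  by case/and3P: qst => _ rs _; apply: (inj s' s t).
by rewrite As.
Qed.

(** * Families of edge-disjoint pentagons without rainbow triangle *)

Definition on_pentagon (V : finType) (c : 'I_5 -> V) (x y : V) : bool :=
  [exists j, (x == c j) && ((y == c (nxt j)) || (y == c (prv j)))].

Record pentagons (V : finType) (k : nat) := Pentagons {
  vtx :> 'I_k -> 'I_5 -> V;
  vtx_inj : forall i, injective (vtx i);
  color_uniq : forall a b x y,
    on_pentagon (vtx a) x y -> on_pentagon (vtx b) x y -> a = b;
  no_rainbow : forall a b g x y z, on_pentagon (vtx a) x y ->
    on_pentagon (vtx b) y z -> on_pentagon (vtx g) x z ->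
    [\/ a = b, b = g | a = g] }.

Lemma on_pentagonP (V : finType) (c : 'I_5 -> V) x y :
  reflect (exists j, x = c j /\ (y = c (nxt j) \/ y = c (prv j)))
    (on_pentagon c x y).
Proof.
apply: (iffP existsP) => -[j].
  by case/andP => /eqP-> /orP[] /eqP->; exists j; split=> //; [left|right].
by case=> -> [] ->; exists j; rewrite eqxx //= eqxx ?orbT.
Qed.

Lemma on_pentagon_sym (V : finType) (c : 'I_5 -> V) : symmetric (on_pentagon c).
Proof.
suff S x y : on_pentagon c x y -> on_pentagon c y x.
  by move=> x y; apply/idP/idP; apply: S.
case/on_pentagonP=> j [-> [] ->]; apply/on_pentagonP.
  by exists (nxt j); split=> //; right; rewrite addrK.
by exists (prv j); split=> //; left; rewrite subrK.
Qed.

Lemma on_pentagon_codom (V : finType) (c : 'I_5 -> V) x y :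
  on_pentagon c x y -> x \in codom c.
Proof. by case/on_pentagonP=> j [-> _]; apply: codom_f. Qed.

Definition union_adj V k (P : pentagons V k) : rel V :=
  fun x y => [exists i, on_pentagon (P i) x y].

Lemma union_adjP V k (P : pentagons V k) x y :
  reflect (exists i, on_pentagon (P i) x y) (union_adj P x y).
Proof. exact: existsP. Qed.

Lemma union_adj_sym V k (P : pentagons V k) : symmetric (union_adj P).
Proof. by move=> x y; apply: eq_existsb => i; apply: on_pentagon_sym. Qed.

Lemma on_pentagon_edge V k (P : pentagons V k) i j :
  on_pentagon (P i) (P i j) (P i (nxt j)).
Proof. by apply/on_pentagonP; exists j; split=> //; left. Qed.

Lemma on_pentagon_vtx V k (P : pentagons V k) i j j' :
  on_pentagon (P i) (P i j) (P i j') = (j' == nxt j) || (j' == prv j).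
Proof.
apply/on_pentagonP/orP => [[l [/vtx_inj<- []/vtx_inj->]]|[]/eqP->].
- by left.
- by right.
- by exists j; split=> //; left.
- by exists j; split=> //; right.
Qed.

Lemma union_adj_irr V k (P : pentagons V k) : irreflexive (union_adj P).
Proof.
move=> x; case: (union_adjP P x x) => // -[i] xx.
have /codomP[j e] := on_pentagon_codom xx.
move: xx; rewrite e on_pentagon_vtx.
by case: j {e} => [[|[|[|[|[|//]]]]] ?].
Qed.

Definition edge V k (P : pentagons V k) i j : {set V} :=
  [set P i j; P i (nxt j)].

(** An edge knows its pentagon because the pentagons are edge-disjoint. *)
Lemma edge_inj V k (P : pentagons V k) i j i' j' :
  edge P i j = edge P i' j' -> (i, j) = (i', j').
Proof.
move=> E.
have jE : P i j \in edge P i' j' by rewrite -E !inE eqxx.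
have j1E : P i (nxt j) \in edge P i' j' by rewrite -E !inE eqxx orbT.
have nloop : P i j != P i (nxt j).
  by apply/eqP => /vtx_inj; case: j {E jE j1E} => [[|[|[|[|[|//]]]]] ?].
have ii' : i = i'.
  have := on_pentagon_edge P i j; have h := on_pentagon_edge P i' j'.
  move: jE j1E nloop; rewrite !inE => /orP[]/eqP-> /orP[]/eqP->;
    rewrite ?eqxx // => _ h'; first exact: color_uniq h' h.
  by apply: color_uniq h' _; rewrite on_pentagon_sym.
rewrite -{i'}ii' in E jE j1E *.
move: j1E jE; rewrite !inE !(inj_eq (@vtx_inj _ _ P i)).
case/orP=> /eqP e1 /orP[]/eqP e2; try by rewrite e2.
  (* Two consecutive edges never coincide: 2 <> 0 modulo 5. *)
  move: e2; rewrite -e1 => /eqP.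
  by case: j {E nloop e1} => [[|[|[|[|[|//]]]]] ?].
by rewrite (addIr _ e1).
Qed.

(** * Degrees *)

Definition deg V k (P : pentagons V k) v := (\sum_u union_adj P v u).

Lemma sum_codom V k (P : pentagons V k) i (F : V -> nat) :
  (\sum_(u in codom (P i)) F u = \sum_j F (P i j)).
Proof.
rewrite -big_uniq; last by rewrite map_inj_uniq ?enum_uniq //; apply: vtx_inj.
by rewrite big_map big_enum.
Qed.

(** Each pentagon through a vertex accounts for two of its edges. *)
Lemma deg_vtx V k (P : pentagons V k) v :
  deg P v = (2 * \sum_i \sum_j (P i j == v)).
Proof.
have E u : union_adj P v u = (\sum_i on_pentagon (P i) v u) :> nat.
  case: (boolP (union_adj P v u)) => [/union_adjP[i vu]|/union_adjP no].
    rewrite (bigD1 i) //= vu big1 // => i' ni.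
    case: (boolP (on_pentagon (P i') v u)) => // vu'.
    by rewrite (color_uniq vu' vu) eqxx in ni.
  rewrite big1 // => i _; case: (boolP (on_pentagon _ _ _)) => // vu.
  by case: no; exists i.
rewrite /deg (eq_bigr _ (fun u _ => E u)) exchange_big big_distrr /=.
apply: eq_bigr => i _.
have [/codomP[j ->]|nv] := boolP (v \in codom (P i)); last first.
  rewrite !big1 ?muln0 //.
    by move=> j _; case: eqP => // e; rewrite -e codom_f in nv.
  move=> u _; case: (boolP (on_pentagon _ _ _)) => // /on_pentagon_codom.
  by rewrite (negbTE nv).
rewrite [in RHS](bigD1 j) //= eqxx [X in true + X]big1 ?addn0; last first.
  by move=> j' nj; rewrite (inj_eq (@vtx_inj _ _ P i)) (negbTE nj).
rewrite (bigID (fun u => u \in codom (P i))) /= sum_codom.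
rewrite [X in (_ + X)]big1 ?addn0; last first.
  move=> u nu; case: (boolP (on_pentagon _ _ _)) => //.
  by rewrite on_pentagon_sym => /on_pentagon_codom; rewrite (negbTE nu).
rewrite (eq_bigr (fun l => (l == nxt j) || (l == prv j) : nat)); last first.
  by move=> l _; rewrite on_pentagon_vtx.
rewrite big_positions.
by case: j => [[|[|[|[|[|//]]]]] ?].
Qed.

Lemma sum_deg V k (P : pentagons V k) : (\sum_v deg P v = 10 * k).
Proof.
under eq_bigr do rewrite deg_vtx.
rewrite -big_distrr /= exchange_big /=.
under eq_bigr do rewrite exchange_big /=.
rewrite (eq_bigr (fun=> 5)) ?sum_nat_const ?card_ord; first lia.
move=> i _; rewrite (eq_bigr (fun=> 1)) ?sum_nat_const ?card_ord // => j _.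
rewrite (bigD1 (P i j)) //= eqxx big1 ?addn0 // => v /negbTE.
by rewrite eq_sym => ->.
Qed.

Lemma sum_deg2 V k (P : pentagons V k) :
  (\sum_v deg P v ^ 2 = 2 * \sum_i \sum_j deg P (P i j)).
Proof.
rewrite (eq_bigr (fun v => 2 * \sum_i \sum_j (P i j == v) * deg P v));
  last first.
  move=> v _; rewrite expnS expn1 {1}deg_vtx -mulnA big_distrl; congr (2 * _).
  by apply: eq_bigr => i _; rewrite big_distrl.
rewrite -big_distrr /= exchange_big /=; congr (2 * _).
apply: eq_bigr => i _; rewrite exchange_big /=; apply: eq_bigr => j _.
rewrite (bigD1 (P i j)) //= eqxx mul1n big1 ?addn0 // => v /negbTE.
by rewrite eq_sym => ->.
Qed.

(** * Triangles and chords *)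

Definition sees_edge V k (P : pentagons V k) (i : 'I_k) j u :=
  union_adj P u (P i j) && union_adj P u (P i (nxt j)).

Definition outer_triangles V k (P : pentagons V k) i :=
  (\sum_(u | u \notin codom (P i)) \sum_j sees_edge P i j u).

(** The truncated subtraction is exact by [runs_at_most_two]. *)
Definition slack V k (P : pentagons V k) i u :=
  (2 + \sum_j sees_edge P i j u - \sum_j union_adj P u (P i j)).
Definition defect V k (P : pentagons V k) i :=
  (\sum_(u | u \notin codom (P i)) slack P i u).

(** A chord is indexed by the position that it cuts off. *)
Definition chord V k (P : pentagons V k) i j :=
  union_adj P (P i (prv j)) (P i (nxt j)).

(** Both chords that end at position j. *)
Definition double_chord V k (P : pentagons V k) i j :=
  chord P i (prv j) && chord P i (nxt j).

(** Outside vertices contribute by [runs_at_most_two]; among the five vertices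
    themselves, there are ten ordered adjacent pairs and two for each chord. *)
Lemma degree_on_pentagon V k (P : pentagons V k) i :
  (\sum_j deg P (P i j) + defect P i
     <= 2 * #|V| + outer_triangles P i + 2 * \sum_j chord P i j).
Proof.
have inside : (\sum_j \sum_j' union_adj P (P i j) (P i j')
    <= 10 + 2 * \sum_j chord P i j).
  have E : (\sum_j \sum_j' union_adj P (P i j) (P i j') <=
            \sum_(j < 5) (2 + chord P i (nxt j) + chord P i (prv j))).
    apply: leq_sum => j _.
    rewrite (reindex_inj (@addrI _ j)) /= big_positions addr0.
    rewrite union_adj_irr add0n.
    rewrite /chord addrK !addrA subrK.
    rewrite [union_adj P (P i (prv (prv j))) _]union_adj_sym.
    move: (union_adj _ _ (P i (nxt j))) (union_adj _ _ (P i (prv j))).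
    by move: (union_adj _ _ _) (union_adj _ _ _) => [] [] [] [].
  apply: leq_trans E _; rewrite !big_split /= sum_nat_const card_ord.
  have R (t : 'I_5) : (\sum_j chord P i (j + t)%R = \sum_j chord P i j).
    by rewrite [RHS](reindex_inj (@addIr _ t)).
  by rewrite (R 1%R) (R (-1)%R) mul2n -addnn addnA.
have outside : (\sum_(u | u \notin codom (P i)) \sum_j union_adj P u (P i j)
   + defect P i <= \sum_(u | u \notin codom (P i)) 2 + outer_triangles P i).
  rewrite /defect /outer_triangles -!big_split /=; apply: leq_sum => u _.
  by rewrite /slack subnKC //; apply: runs_at_most_two.
have -> : (\sum_j deg P (P i j) = \sum_u \sum_j union_adj P u (P i j)).
  rewrite exchange_big /=; apply: eq_bigr => j _; apply: eq_bigr => u _.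
  by rewrite union_adj_sym.
rewrite (bigID (fun u => u \in codom (P i))) /= sum_codom.
have : (\sum_(u in codom (P i)) 2 + \sum_(u | u \notin codom (P i)) 2
   = 2 * #|V|).
  by rewrite -(bigID (fun u => u \in codom (P i)) predT) /= sum_nat_const mulnC.
rewrite sum_codom sum_nat_const card_ord => <-; rewrite -addnA.
apply: leq_trans (leq_add inside outside) _.
by move: (\sum_j _) (\sum_(u | _) 2) (outer_triangles P i) => *; lia.
Qed.

(** The set A is unordered, since the direction in which the pentagon p.1
    traverses its two edges at u is arbitrary. *)
Definition passes_between V k (P : pentagons V k) u (A : {set V})
    (p : 'I_k * 'I_5) :=
  (P p.1 p.2 == u) && ([set P p.1 (prv p.2); P p.1 (nxt p.2)] == A).

(** Here the rainbow condition is used: the two edges at u avoid the color of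
    the base, so they share a color and are consecutive on their pentagon. *)
Lemma triangle_passes_between V k (P : pentagons V k) i j u :
  sees_edge P i j u -> ~~ on_pentagon (P i) u (P i j) ->
  ~~ on_pentagon (P i) u (P i (nxt j)) ->
  exists p, chord P p.1 p.2 && passes_between P u (edge P i j) p.
Proof.
case/andP=> /union_adjP[a ua] /union_adjP[b ub] n1 n2.
have eij := on_pentagon_edge P i j.
have ab : a = b.
  case: (no_rainbow ua eij ub) => // e; first by rewrite e (negbTE n1) in ua.
  by rewrite -e (negbTE n2) in ub.
rewrite -{b}ab in ub.
have chd : union_adj P (P i j) (P i (nxt j)) by apply/union_adjP; exists i.
have ne : P i j <> P i (nxt j).
  by move=> e; rewrite e union_adj_irr in chd.
case/on_pentagonP: ua => l [ul vl].
case/on_pentagonP: ub => l' [ul' wl'].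
have ll : l' = l by apply: (@vtx_inj _ _ P a); rewrite -ul -ul'.
rewrite {l' ul'}ll in wl'.
exists (a, l); rewrite /passes_between /chord /edge /= ul eqxx.
case: vl wl' ne chd => -> [] -> // _ chd.
  by rewrite union_adj_sym chd setUC eqxx.
by rewrite chd eqxx.
Qed.

Lemma passes_between_uniq V k (P : pentagons V k) u u' A A' p :
  passes_between P u A p -> passes_between P u' A' p -> u = u' /\ A = A'.
Proof. by move=> /andP[/eqP<- /eqP<-] /andP[/eqP<- /eqP<-]. Qed.

(** Send a triangle to the chord that [triangle_passes_between] provides. *)
Lemma sum_outer_triangles V k (P : pentagons V k) :
  (\sum_i outer_triangles P i <= \sum_i \sum_j chord P i j).
Proof.
have -> : (\sum_i outer_triangles P i = \sum_(t : 'I_k * 'I_5 * V |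
    (t.2 \notin codom (P t.1.1)) && sees_edge P t.1.1 t.1.2 t.2) 1).
  rewrite /outer_triangles; under eq_bigr do rewrite exchange_big /=.
  rewrite pair_bigA /= big_mkcondr /=.
  rewrite -(pair_big_dep xpredT (fun p u => u \notin codom (P p.1))
      (fun p u => if sees_edge P p.1 p.2 u then 1 else 0)) /=.
  by apply: eq_bigr => -[i j] _; apply: eq_bigr => u _; case: sees_edge.
have -> : (\sum_i \sum_j chord P i j =
    \sum_(p : 'I_k * 'I_5 | chord P p.1 p.2) 1).
  rewrite pair_bigA /= [RHS]big_mkcond /=; apply: eq_bigr => p _.
  by case: chord.
apply: (@leq_sum_rel _ _ _ _
  (fun t => passes_between P t.2 (edge P t.1.1 t.1.2))).
  move=> [[i j] u] /= /andP[nu sp].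
  have nc x : ~~ on_pentagon (P i) u x.
    by apply/negP => /on_pentagon_codom; apply/negP.
  have [p /andP[cp clp]] := triangle_passes_between sp (nc _) (nc _).
  by exists p; split.
move=> [[i j] u] [[i' j'] u'] p /= _ _ cl cl'.
by have [-> /edge_inj ->] := passes_between_uniq cl cl'.
Qed.

(** The chords of a pentagon form a pentagon again, so [runs_at_most_two]
    applies with step 2; consecutive edges of that pentagon are double
    chords. *)
Lemma chords_le V k (P : pentagons V k) i :
  (\sum_j chord P i j <= 2 + \sum_j double_chord P i j).
Proof.
apply: leq_trans (@runs_at_most_two (chord P i) (nxt 1) isT) _.
rewrite leq_add2l [X in (_ <= X)](reindex_inj (@addIr _ (1%R : 'I_5))) /=.
by apply: leq_sum => j _; rewrite /double_chord addrK addrA.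
Qed.

(** The apex has small degree.  The two chords at it are edges of the pentagon
    p.1, so a neighbour off both pentagons that is adjacent to another vertex of
    the pentagon i sees an edge of i or of p.1; a neighbour without this second
    adjacency contributes to the defect of i. *)
Lemma deg_double_chord V k (P : pentagons V k) i j : double_chord P i j ->
  exists p, passes_between P (P i j) (edge P i (nxt (nxt j))) p /\
   deg P (P i j) <=
     10 + defect P i + outer_triangles P i + outer_triangles P p.1.
Proof.
case/andP; rewrite /chord addrK subrK union_adj_sym => cz cx.
have Ej : nxt (nxt (nxt j)) = prv (prv j).
  by case: j {cz cx} => [[|[|[|[|[|//]]]]] ?]; apply: val_inj.
have [|||p /andP[_ clp]] :=
  @triangle_passes_between _ _ P i (nxt (nxt j)) (P i j).
- by rewrite /sees_edge cx Ej cz.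
- by rewrite on_pentagon_vtx; case: j {cz cx Ej} => [[|[|[|[|[|//]]]]] ?].
- by rewrite on_pentagon_vtx; case: j {cz cx Ej} => [[|[|[|[|[|//]]]]] ?].
exists p; split=> //.
case: p clp => a l /andP[/= /eqP yl /eqP Al].
pose outside b (F : V -> nat) u := if u \notin codom (P b) then F u else 0.
pose inside b u : nat := u \in codom (P b).
pose seen b u := (\sum_l sees_edge P b l u).
have c5 b : (\sum_u inside b u = 5).
  have -> : (\sum_u inside b u = \sum_(u in codom (P b)) 1).
    rewrite [RHS]big_mkcond; apply: eq_bigr => u _.
    by rewrite /inside; case: ifP.
  by rewrite sum_codom sum_nat_const card_ord.
apply: (@leq_trans (\sum_u (inside i u + inside a u + outside i (slack P i) u
    + outside i (seen i) u + outside a (seen a) u))); last first.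
  rewrite !big_split /= !c5 /defect /outer_triangles.
  by rewrite ![(\sum_(u | _ \notin _) _)]big_mkcond.
apply: leq_sum => u _.
have [yu /=|] := boolP (union_adj P (P i j) u); last by [].
rewrite union_adj_sym in yu.
rewrite /inside /outside; case: (boolP (u \in codom (P i))) => //= ui.
case: (boolP (u \in codom (P a))) => //= ua.
have pos b m : sees_edge P b m u -> 0 < seen b u.
  by move=> sp; rewrite /seen (bigD1 m) //= sp.
rewrite !addn_gt0 /=.
have [j' /andP[nj' uj']|no] :=
  pickP [pred j' | (j' != j) && union_adj P u (P i j')];
  last first.
  rewrite subn_gt0 ltn_addr // (bigD1 j) //= yu big1 // => j' nj'.
  by have /= := no j'; rewrite nj' /= => ->.
move/other_positions: nj'; rewrite orbA => /orP[/orP[]/eqP e|near].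
- by rewrite (pos i j) ?orbT // /sees_edge yu -e.
- by rewrite (pos i (prv j)) ?orbT // /sees_edge subrK yu -e uj'.
have : P i j' \in [set P a (prv l); P a (nxt l)].
  by rewrite Al /edge !inE; case/orP: near => /eqP->; rewrite eqxx ?orbT.
rewrite !inE => /orP[]/eqP e.
  by rewrite (pos a (prv l)) ?orbT // /sees_edge subrK yl -e uj' yu.
by rewrite (pos a l) ?orbT // /sees_edge yl -e uj' yu.
Qed.

(** * Double chords are rare *)

Definition num_double_chords V k (P : pentagons V k) :=
  \sum_i \sum_j double_chord P i j.

Lemma sum_over_double_chords V k (P : pentagons V k) (F : 'I_k -> 'I_5 -> nat) :
  \sum_(p : 'I_k * 'I_5 | double_chord P p.1 p.2) F p.1 p.2 =
  \sum_i \sum_j double_chord P i j * F i j.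
Proof.
rewrite big_mkcond pair_bigA /=; apply: eq_bigr => p _.
by case: double_chord; rewrite ?mul1n ?mul0n.
Qed.

(** The pentagon supplied by [deg_double_chord], together with the position of
    the apex on it, determines the double chord; so no pentagon is supplied more
    than five times. *)
Lemma sum_deg_double_chord V k (P : pentagons V k) :
  \sum_i \sum_j double_chord P i j * deg P (P i j) <=
  10 * num_double_chords P + 5 * (\sum_i defect P i)
    + 10 * (\sum_i outer_triangles P i).
Proof.
have le5 (F : 'I_k -> nat) :
    \sum_i \sum_j double_chord P i j * F i <= 5 * \sum_i F i.
  rewrite big_distrr /=; apply: leq_sum => i _; rewrite -big_distrl leq_mul2r.
  rewrite (leq_trans (leq_sum _ (fun j _ => leq_b1 _))) ?orbT //.
  by rewrite sum_nat_const card_ord.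
(* The part of the degree that only the other pentagon can pay for. *)
pose F i j := deg P (P i j) - (10 + defect P i + outer_triangles P i).
have third : \sum_i \sum_j double_chord P i j * F i j <=
    5 * \sum_i outer_triangles P i.
  rewrite -sum_over_double_chords.
  have -> : 5 * \sum_i outer_triangles P i =
      \sum_(p : 'I_k * 'I_5 | true) outer_triangles P p.1.
    rewrite -(pair_bigA _ (fun i _ => outer_triangles P i)) /= big_distrr /=.
    by apply: eq_bigr => i _; rewrite sum_nat_const card_ord.
  apply: (@leq_sum_rel _ _ _ _
    (fun s => passes_between P (P s.1 s.2) (edge P s.1 (nxt (nxt s.2))))).
    move=> [i j] /= /deg_double_chord[p [cl le]]; exists p; split=> //.
    by rewrite leq_subLR.
  move=> [i j] [i' j'] p /= _ _ cl cl'.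
  have [_ /edge_inj e] := passes_between_uniq cl cl'.
  have -> : i = i' := congr1 fst e.
  have e2 : nxt (nxt j) = nxt (nxt j') := congr1 snd e.
  by rewrite (addIr _ (addIr _ e2)).
apply: (@leq_trans (\sum_i \sum_j (double_chord P i j * 10 +
    double_chord P i j * defect P i +
    double_chord P i j * outer_triangles P i + double_chord P i j * F i j))).
  apply: leq_sum => i _; apply: leq_sum => j _.
  by rewrite -!mulnDr leq_mul2l /F -leq_subLR leqnn orbT.
under eq_bigr do rewrite !big_split /=.
rewrite !big_split /=.
have -> : \sum_i \sum_j double_chord P i j * 10 = 10 * num_double_chords P.
  rewrite /num_double_chords big_distrr /=; apply: eq_bigr => i _.
  by rewrite mulnC big_distrl.
apply: leq_trans
  (leq_add (leq_add (leq_add (leqnn _) (le5 _)) (le5 _)) third) _.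
by rewrite -addnA leq_add2l -mulnDl.
Qed.

(** A pentagon has at most one double chord with a given apex. *)
Lemma double_chords_at V k (P : pentagons V k) v :
  \sum_i \sum_j (double_chord P i j && (P i j == v)) <= deg P v.
Proof.
rewrite deg_vtx mul2n -addnn; apply: leq_trans (leq_addr _ _).
by apply: leq_sum => i _; apply: leq_sum => j _; case: double_chord.
Qed.

Lemma deg_le V k (P : pentagons V k) v : deg P v <= #|V|.
Proof.
by rewrite -sum1_card; apply: leq_sum => u _; apply: leq_b1.
Qed.

Lemma pentagons_le V k (P : pentagons V k) : 10 * k <= #|V| ^ 2.
Proof.
rewrite -(sum_deg P) -mulnn -sum_nat_const.
by apply: leq_sum => v _; apply: deg_le.
Qed.

Lemma num_double_chords_le V k (P : pentagons V k) :
  num_double_chords P <= 5 * k.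
Proof.
apply: (@leq_trans (\sum_(i < k) \sum_(j < 5) 1)).
  by apply: leq_sum => i _; apply: leq_sum => j _; apply: leq_b1.
by rewrite !sum_nat_const !card_ord muln1 mulnC.
Qed.

Lemma sum_over_vertices V k (P : pentagons V k) (F : V -> nat) :
  \sum_v (\sum_i \sum_j (double_chord P i j && (P i j == v))) * F v =
  \sum_i \sum_j double_chord P i j * F (P i j).
Proof.
under eq_bigr do rewrite big_distrl /=.
rewrite exchange_big; apply: eq_bigr => i _.
under eq_bigr do rewrite big_distrl /=.
rewrite exchange_big; apply: eq_bigr => j _.
rewrite (bigD1 (P i j)) //= eqxx andbT big1 ?addn0 // => v /negbTE.
by rewrite eq_sym => ->; rewrite andbF.
Qed.

Local Open Scope ring_scope.

Lemma sum_sqr_dev V k (P : pentagons V k) :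
  \sum_v (2 * #|V|%:R - 5 * (deg P v)%:R) ^+ 2 =
  50 * (\sum_i \sum_j deg P (P i j))%:R - 200 * #|V|%:R * k%:R
    + 4 * #|V|%:R ^+ 3 :> rat.
Proof.
rewrite (eq_bigr (fun v => 25 * (deg P v ^ 2)%:R - 20 * #|V|%:R * (deg P v)%:R
   + 4 * #|V|%:R ^+ 2)); last by move=> v _; rewrite natrX; ring.
rewrite !big_split /= sumrN -!mulr_sumr -!natr_sum sum_deg sum_deg2.
rewrite sumr_const -[_ *+ #|_|]mulr_natr !natrM; ring.
Qed.

(** At a vertex of degree d that carries b double chords, 5nb <= 25bd when
    5d >= n; otherwise b <= d gives 5nb <= n ^ 2 <= (2n - 5d) ^ 2. *)
Lemma num_double_chords_sparse V k (P : pentagons V k) :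
  5 * #|V|%:R * (num_double_chords P)%:R <=
  25 * (\sum_i \sum_j double_chord P i j * deg P (P i j))%:R
  + \sum_v (2 * #|V|%:R - 5 * (deg P v)%:R) ^+ 2 :> rat.
Proof.
pose b v := (\sum_i \sum_j (double_chord P i j && (P i j == v)))%N.
have -> : num_double_chords P = (\sum_v b v)%N.
  have /= := sum_over_vertices P (fun=> 1%N).
  under eq_bigr do rewrite muln1; move=> ->.
  by apply: eq_bigr => i _; apply: eq_bigr => j _; rewrite muln1.
rewrite -sum_over_vertices !natr_sum !mulr_sumr -big_split /=.
apply: ler_sum => v _; rewrite -/(b v) natrM.
have : (b v)%:R <= (deg P v)%:R :> rat by rewrite ler_nat double_chords_at.
have : 0 <= (b v)%:R :> rat by [].
have : 0 <= #|V|%:R :> rat by [].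
move: (b v)%:R (deg P v)%:R #|V|%:R => x d n n0 x0 xd.
have [le|lt] := lerP n (5 * d).
  have : 0 <= x * (5 * d - n) by rewrite mulr_ge0 // subr_ge0.
  have := sqr_ge0 (2 * n - 5 * d); lra.
have : 0 <= n * (d - x) by rewrite mulr_ge0 // subr_ge0.
have : 0 <= x * d by rewrite mulr_ge0 // (le_trans x0).
have : 0 <= (n - 5 * d) * (3 * n - 5 * d) by rewrite mulr_ge0; lra.
have : 0 <= n * (n - 5 * d) by rewrite mulr_ge0 //; lra.
nra.
Qed.

(** * The bound on the number of pentagons *)

(** With Y = 25k - n^2 assumed to exceed 3n + 5000, C chords and B double
    chords, the degree sums give 4nY <= 150 C <= 300k + 150 B.  The estimate of
    double chords gives nB <= 1125k, hence B = O(n), and then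
    (4n - 12) Y <= 12 n^2 + O(n), so Y <= 3n + O(1).  The constants 50 and 5000
    are not optimized. *)
Lemma pentagons_bound V k (P : pentagons V k) :
  (50 <= #|V|)%N -> (25 * k <= #|V| ^ 2 + 3 * #|V| + 5000)%N.
Proof.
move=> n50; rewrite leqNgt -(ltr_nat rat); apply/negP => big.
pose Sl := (\sum_i defect P i)%N; pose T := (\sum_i outer_triangles P i)%N.
pose Ch := (\sum_i \sum_j chord P i j)%N.
pose W := (\sum_i \sum_j deg P (P i j))%N.
have hW : (W + Sl <= 2 * #|V| * k + T + 2 * Ch)%N.
  rewrite /W /Sl -big_split /=.
  apply: leq_trans (leq_sum _ (fun i _ => degree_on_pentagon P i)) _.
  rewrite big_split leq_add //=; last by rewrite -big_distrr.
  by rewrite big_split sum_nat_const card_ord mulnC.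
have hT : (T <= Ch)%N := sum_outer_triangles P.
have hC : (Ch <= 2 * k + num_double_chords P)%N.
  apply: leq_trans (leq_sum _ (fun i _ => chords_le P i)) _.
  by rewrite big_split /= sum_nat_const card_ord mulnC.
have hB := num_double_chords_le P.
have hS := sum_deg_double_chord P; rewrite -/Sl -/T in hS.
have hk := pentagons_le P.
have hD := num_double_chords_sparse P.
have Q0 : 0 <= \sum_v (2 * #|V|%:R - 5 * (deg P v)%:R) ^+ 2 :> rat.
  by apply: sumr_ge0 => v _; apply: sqr_ge0.
have := sum_sqr_dev P; rewrite -/W.
move: {Q0}(\sum_v _) Q0 hD => Q Q0 hD hQ.
move: hW hT hC hB hS hk hD hQ n50 big.
rewrite -!(ler_nat rat) !(natrD, natrM, natrX).
set SD := (\sum_i \sum_j _)%N.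
have : 0 <= Sl%:R :> rat by [].
move: Sl%:R T%:R Ch%:R W%:R (num_double_chords P)%:R SD%:R k%:R #|V|%:R Q Q0.
move=> S' T' C W' B D K n Q Q0 S0 hW hT hC hB hS hk hD hQ n50 big.
(* The main inequality, kept with the nonnegative terms Q and S' that the
   estimate of the double chords consumes. *)
have e1 : Q + 50 * S' + 4 * n * (25 * K - n ^+ 2) <= 150 * C by nra.
have Y0 : 0 <= n * (25 * K - n ^+ 2) by rewrite mulr_ge0; clear - n50 big; lra.
have e2 : n * B <= 1125 * K by lra.
have n0 : 0 < n by lra.
(* Since 10 k <= n ^ 2, as the degrees are at most n. *)
have e3 : B <= 225 / 2 * n.
  rewrite -(ler_pM2l n0); nra.
have e4 : 4 * n * (25 * K - n ^+ 2) <= 12 * (25 * K) + 16875 * n by lra.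
have : 0 <= (4 * n - 12) * (25 * K - n ^+ 2 - 3 * n - 5000).
  by rewrite mulr_ge0; [|clear - n50|clear - big]; lra.
clear - e4 big n50; nra.
Qed.

(** * From decompositions to families of pentagons *)

Local Open Scope nat_scope.

Lemma cycle_adj5 (i j : 'I_5) :
  @adj (cycle_graph 5) i j = (j == (i + 1)%R) || (j == (i - 1)%R).
Proof.
by case: i => [[|[|[|[|[|//]]]]] ?]; case: j => [[|[|[|[|[|//]]]]] ?].
Qed.

Lemma cycle_adj3 (i j : 'I_3) : @adj (cycle_graph 3) i j = (i != j).
Proof. by case: i => [[|[|[|//]]] ?]; case: j => [[|[|[|//]]] ?]. Qed.

Lemma cycle5_parametrization (G : sgraph) (S : subgraph G) :
  isomorphic (sgraph_of S) (cycle_graph 5) ->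
  exists c : 'I_5 -> G, injective c /\
    forall x y, sub_adj S x y = on_pentagon c x y.
Proof.
move=> [f [g fK gK] fE]; exists (fun j => val (g j)).
split=> [i j /val_inj/(can_inj gK) //|x y].
have adj_g i j : sub_adj S (val (g i)) (val (g j)) =
    (j == (i + 1)%R) || (j == (i - 1)%R).
  by rewrite -cycle_adj5 -{2}[i]gK -{2}[j]gK fE.
apply/idP/on_pentagonP => [xy|[j [-> [] ->]]]; last 2 first.
- by rewrite adj_g eqxx.
- by rewrite adj_g eqxx orbT.
have /and3P[xS yS _] := sub_adjP xy.
pose x' : sgraph_of S := exist _ x xS; pose y' : sgraph_of S := exist _ y yS.
have := adj_g (f x') (f y'); rewrite !fK /= xy => /esym/orP yE.
exists (f x'); rewrite fK; split=> //.
by case: yE => /eqP <-; rewrite fK; [left|right].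
Qed.

Definition triangle_adj (G : sgraph) (A : {set G}) : rel G :=
  fun u v => [&& u != v, u \in A & v \in A].

Lemma triangle_adj_sym (G : sgraph) (A : {set G}) : symmetric (triangle_adj A).
Proof.
by move=> u v; rewrite /triangle_adj eq_sym [(u \in A) && _]andbC.
Qed.

Lemma triangle_subgraph (G : sgraph) (A : {set G}) : #|A| = 3 ->
  (forall u v, u \in A -> v \in A -> u != v -> adj u v) ->
  exists2 S : subgraph G, isomorphic (sgraph_of S) (cycle_graph 3) &
    forall u v, sub_adj S u v = [&& u != v, u \in A & v \in A].
Proof.
move=> A3 Aadj.
have AP u v : triangle_adj A u v -> [&& u \in A, v \in A & adj u v].
  by case/and3P=> uv uA vA; rewrite uA vA Aadj.
exists (Subgraph (@triangle_adj_sym G A) AP) => //.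
have c3 : #|{: {u | u \in A}}| = 3 by rewrite card_sig -A3; apply: eq_card.
exists (fun u => cast_ord c3 (enum_rank u)).
  apply: bij_comp (@enum_rank_bij _).
  by exists (cast_ord (esym c3)); [apply: cast_ordK | apply: cast_ordKV].
move=> u v; rewrite cycle_adj3 (inj_eq (@cast_ord_inj _ _ _)).
rewrite (inj_eq enum_rank_inj) -(inj_eq val_inj).
case: u v => [u /= uA] [v /= vA].
by rewrite /sgraph_of_adj /= /triangle_adj uA vA !andbT.
Qed.

Lemma mem_edge_set (V : finType) (e : rel V) x y : symmetric e ->
  ([set x; y] \in edge_set e) = e x y.
Proof.
move=> es; apply/edge_setP/idP => [[u [v [uv E]]]|xy]; last by exists x, y.
have xx : x \in [set u; v] by rewrite -E !inE eqxx.
have yy : y \in [set u; v] by rewrite -E !inE eqxx orbT.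
have uu : u \in [set x; y] by rewrite E !inE eqxx.
have vv : v \in [set x; y] by rewrite E !inE eqxx orbT.
move: xx yy uu vv uv; rewrite !inE.
by move=> /orP[]/eqP ? /orP[]/eqP ? /orP[]/eqP ? /orP[]/eqP ? ?; subst;
   rewrite // es.
Qed.

(** Three pairwise distinct colors would make the triangle on x, y, z
    multicolored, as each of its edges lies in exactly one member of the
    decomposition. *)
Lemma no_rainbow_triangle (G : sgraph) k (D : 'I_k -> subgraph G) :
  (forall i j, i != j -> [disjoint sub_edges (D i) & sub_edges (D j)]) ->
  (forall S : subgraph G,
     isomorphic (sgraph_of S) (cycle_graph 3) -> ~ multicolored D S) ->
  forall a b g x y z, sub_adj (D a) x y -> sub_adj (D b) y z ->
    sub_adj (D g) x z -> [\/ a = b, b = g | a = g].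
Proof.
move=> dis nomc a b g x y z xy yz xz.
apply: contrapT => dist; have [ab bg ag] : [/\ a <> b, b <> g & a <> g].
  by split=> e; apply: dist; [constructor 1|constructor 2|constructor 3].
have ne i u v : sub_adj (D i) u v -> u != v.
  by case/sub_adjP/and3P=> _ _; apply: contraTneq => ->; rewrite adj_irrefl.
have adjD i u v : sub_adj (D i) u v -> adj u v.
  by case/sub_adjP/and3P.
pose A := [set x; y; z].
have A3 : #|A| = 3.
  rewrite /A -setUA cardsU1 cards2 !inE negb_or.
  by rewrite (ne _ _ _ xy) (ne _ _ _ xz) (ne _ _ _ yz).
have Aadj u v : u \in A -> v \in A -> u != v -> adj u v.
  rewrite !inE => /orP[/orP[]|] /eqP-> /orP[/orP[]|] /eqP->;
    rewrite ?eqxx // => _;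
  by rewrite ?(adjD _ _ _ xy, adjD _ _ _ yz, adjD _ _ _ xz) // adj_sym
     ?(adjD _ _ _ xy, adjD _ _ _ yz, adjD _ _ _ xz).
have [S iS SE] := triangle_subgraph A3 Aadj.
apply: (nomc S iS) => i; apply/card_le1_eqP.
have col e j : e \in sub_edges (D i) -> e \in sub_edges (D j) -> i = j.
  move=> ei ej; apply/eqP/negPn/negP => /dis /pred0P /(_ e) /=.
  by rewrite ei ej.
have inD j u v : sub_adj (D j) u v -> [set u; v] \in sub_edges (D j).
  by move=> uv; rewrite mem_edge_set //; apply: sub_adj_sym.
have edgeP e : e \in sub_edges S -> e \in sub_edges (D i) ->
    [\/ e = [set x; y] /\ i = a, e = [set y; z] /\ i = b
      | e = [set x; z] /\ i = g].
  move=> eS ei.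
  suff [E|E|E] : [\/ e = [set x; y], e = [set y; z] | e = [set x; z]].
  - by constructor 1; split=> //; apply: col ei _; rewrite E; apply: inD xy.
  - by constructor 2; split=> //; apply: col ei _; rewrite E; apply: inD yz.
  - by constructor 3; split=> //; apply: col ei _; rewrite E; apply: inD xz.
  case/edge_setP: eS => u [v [+ ->]]; rewrite SE !inE => /and3P[uv uA vA].
  move: uA vA uv => /orP[/orP[]|] /eqP-> /orP[/orP[]|] /eqP->;
    rewrite ?eqxx //= => _.
  - by constructor 1.
  - by constructor 3.
  - by constructor 1; rewrite setUC.
  - by constructor 2.
  - by constructor 3; rewrite setUC.
  - by constructor 2; rewrite setUC.
move=> e e'; rewrite !inE => /andP[eS eD] /andP[eS' eD'].
by case: (edgeP e eS eD) (edgeP e' eS' eD') => -[-> ->] [] [-> //]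
   => /esym // /esym.
Qed.

(** * The theorem *)

Lemma admissible_le n k : 50 <= n ->
  ex_admissible (cycle_graph 5) (cycle_graph 3) n k ->
  25 * k <= n ^ 2 + 3 * n + 5000.
Proof.
move=> n50 [G [D [Gn [iso dis _] nomc]]].
have /choice[c cP] := fun i => cycle5_parametrization (iso i).
have cE i x y : on_pentagon (c i) x y = sub_adj (D i) x y.
  by rewrite (cP i).2.
have cinj i : injective (c i) := (cP i).1.
have cuniq a b x y : on_pentagon (c a) x y -> on_pentagon (c b) x y -> a = b.
  rewrite !cE => xa xb; apply/eqP/negPn/negP => /dis /pred0P /(_ [set x; y]) /=.
  by rewrite !mem_edge_set ?xa ?xb //; apply: sub_adj_sym.
have crain a b g x y z : on_pentagon (c a) x y -> on_pentagon (c b) y z ->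
    on_pentagon (c g) x z -> [\/ a = b, b = g | a = g].
  by rewrite !cE; apply: no_rainbow_triangle dis nomc _ _ _ _ _ _.
by have := pentagons_bound (Pentagons cinj cuniq crain); rewrite Gn; apply.
Qed.

Local Open Scope ring_scope.

Theorem theorem1p1 (R : realType) (delta : R) (hdelta : 0 < delta) :
  exists n_delta : nat, forall n : nat, (n_delta <= n)%N ->
    (ex_num (cycle_graph 5) (cycle_graph 3) n)%:R
      <= n%:R ^+ 2 / 25%:R + 3%:R * n%:R / 25%:R + delta * n%:R.
Proof.
have [N hN] : exists N : nat, 200 / delta <= N%:R.
  exists (Num.bound (200 / delta)).
  by rewrite ltW // archi_boundP // divr_ge0 // ltW.
exists (maxn 50 N) => n; rewrite geq_max => /andP[n50 Nn].
have e5 : exists x y : cycle_graph 5, adj x y by exists 0, 1.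
have e3 : exists x y : cycle_graph 3, adj x y by exists 0, 1.
have [/(admissible_le n50) + _] := ex_numP n e5 e3.
rewrite -(ler_nat R) !(natrD, natrM, natrX).
have : 200 <= delta * n%:R.
  by rewrite mulrC -ler_pdivrMr //; apply: le_trans hN _; rewrite ler_nat.
lra.
Qed.
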